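(* Let $\langle R,\sim\rangle$ be the Rado graph. For each maximal antichain $\mathcal A$ in the poset $\langle\mathbb P(R),\subset\rangle$ and each finite set $F_0\subset R$ there is $S\in\mathbb P(R)$ such that $F_0\subset S$ and for every $H\subset F_0$ there is $A\in\mathcal A$ with $S^{F_0}_H\subset A$.
   Context: The Rado graph $\langle R,\sim\rangle$ is the unique countable graph such that $R^H_K\neq\emptyset$ for all finite $K\subset H\subset R$, where $R^H_K=\{v\in R\setminus H:\forall k\in K\,(v\sim k)\wedge\forall h\in H\setminus K\,(v\not\sim h)\}$. For $S\subset R$ and finite $K\subset H$, $S^H_K=S\cap R^H_K$. $\mathbb P(R)$ is the set of subsets of $R$ whose induced subgraph is isomorphic to $R$. Two elements of $\mathbb P(R)$ are compatible iff their intersection contains an element of $\mathbb P(R)$. *)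

(* Defs.v *)
From mathcomp Require Export all_boot.
From mathcomp Require Export boolp classical_sets functions cardinality.

Set Implicit Arguments.
Unset Strict Implicit.
Unset Printing Implicit Defensive.

Local Open Scope classical_set_scope.

Section Rado.
Variables (R : Type) (adj : R -> R -> Prop).
Implicit Types (S H K X Y Z : set R) (A B : set (set R)).

(* [ext S H K] is S^H_K; R^H_K is [ext setT H K]. *)
Definition ext S H K : set R :=
  S `&` [set v | [/\ ~ H v, forall k, K k -> adj v k &
                     forall h, (H `\` K) h -> ~ adj v h]].

Definition simple_graph : Prop :=
  (forall x, ~ adj x x) /\ (forall x y, adj x y -> adj y x).

(* The Rado graph is determined only up to isomorphism, so it is rendered as a
   predicate on graphs. *)
Definition is_rado : Prop :=
  [/\ simple_graph, countable [set: R] &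
      forall H K, finite_set H -> K `<=` H -> ext [set: R] H K !=set0].

(* The set P(R) of copies of the whole graph inside itself. *)
Definition copies : set (set R) :=
  [set S | exists2 f : R -> R, set_bij [set: R] S f &
                               forall x y, adj x y <-> adj (f x) (f y)].

Definition compatible X Y : Prop := exists2 Z, copies Z & Z `<=` X `&` Y.

(* Antichains in the forcing sense: distinct elements are incompatible, not
   merely incomparable. *)
Definition antichain A : Prop :=
  A `<=` copies /\ forall X Y, A X -> A Y -> X <> Y -> ~ compatible X Y.

Definition maximal_antichain A : Prop :=
  antichain A /\ forall B, antichain B -> A `<=` B -> B = A.

End Rado.

(* Main.v *)
(* Fix [F0].  For [B] a subset of [F0] and [x] a vertex, realize inside the Rado
   graph a "clone" [c B x] outside [F0] whose trace on [F0] is [B], with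
   [c B x ~ c B' y] iff [x ~ y].  Each layer [c B] is a copy of the graph, and so
   is its restriction to any copy; hence one can pass to smaller and smaller
   copies, once for each [B], and reach an embedding [f] such that [c B \o f]
   maps into a single element of the antichain for every [B].  The copy [S] is
   the range of the map that fixes [F0] and sends any other [x] to
   [c B (f x)], where [B] is the trace of [x] on [F0]: since the clones do not
   see in which layer they live, this map preserves adjacency. *)
Require Import Defs.

Set Implicit Arguments.
Unset Strict Implicit.
Unset Printing Implicit Defensive.

Local Open Scope classical_set_scope.

Definition graph_embedding (R : Type) (adj : R -> R -> Prop) (f : R -> R) : Prop :=
  forall x y, adj x y <-> adj (f x) (f y).

(** Indexing the traces on [F] by a finite type lets the layers of clones be coded by natural
    numbers and treated one after another. *)
Lemma finite_set_traces (T : Type) (F : set T) : finite_set F ->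
  exists (I : finType) (h : I -> set T) (k : set T -> I),
    forall Q, h (k Q) = F `&` Q.
Proof.
case=> n /card_set_bijP[p [pF pinj _]].
exists {ffun 'I_n -> bool}.
exists (fun B : {ffun 'I_n -> bool} => [set a | F a /\ exists2 m : 'I_n, B m & p a = m]).
exists (fun Q => [ffun m : 'I_n => `[< exists2 a, (F `&` Q) a & p a = m >]]).
move=> Q; apply/seteqP; split=> a /=.
  move=> [Fa [m]]; rewrite ffunE => /asboolP[b [Fb Qb] <-] eq_p.
  by split=> //; rewrite (pinj a b) ?inE.
move=> [Fa Qa]; split=> //; exists (Ordinal (pF a Fa)) => //.
by rewrite ffunE; apply/asboolP; exists a.
Qed.

Section RadoGraph.
Variables (R : Type) (adj : R -> R -> Prop).
Hypothesis hR : is_rado adj.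

(** The extension property for [[set x]] inside [[set x; y]] separates distinct vertices; hence maps
    that preserve and reflect adjacency are injective. *)
Lemma rado_twin_free x y : (forall z, adj z x <-> adj z y) -> x = y.
Proof.
case: hR => _ _ hext tw; apply: contrapT => nxy.
have [v [_ [_ vx vy]]] := hext [set x; y] [set x] (finite_set2 x y) (@subsetUl _ _ _).
apply: (vy y); last by apply/tw; exact: vx.
by split=> [|yx]; [right | exact: nxy].
Qed.

Lemma graph_embedding_inj f : graph_embedding adj f -> injective f.
Proof. by move=> fE x y fxy; apply: rado_twin_free => z; rewrite (fE z x) (fE z y) fxy. Qed.

Lemma graph_embedding_comp f g :
  graph_embedding adj f -> graph_embedding adj g -> graph_embedding adj (f \o g).
Proof. by move=> fE gE x y; rewrite gE fE. Qed.

Lemma copies_range f : graph_embedding adj f -> copies adj (range f).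
Proof.
move=> fE; exists f => //; split=> [x _|x y _ _ /(graph_embedding_inj fE)//|//].
by exists x.
Qed.

(** Vertices are chosen recursively: the extension property is applied to [F] together with all
    earlier choices. *)
Lemma rado_embed_seq (F : set R) (h : nat -> set R) (e : nat -> nat -> Prop) :
  finite_set F ->
  exists g : nat -> R, forall n,
    [/\ ~ F (g n), forall a, F a -> (adj (g n) a <-> h n a) &
        forall m, (m < n)%N -> adj (g n) (g m) <-> e m n].
Proof.
move=> Ffin; have [_ _ hext] := hR.
have [x0 _] := hext set0 set0 (finite_set0 _) (@subset_refl _ _).
(* [s] lists the earlier choices: [old s] is their set, [nbr s] those to which the next vertex must
   be joined. *)
pose old (s : seq R) := nth x0 s @` [set m | (m < size s)%N].
pose nbr (s : seq R) := nth x0 s @` [set m | (m < size s)%N /\ e m (size s)].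
have step (s : seq R) : exists v,
    ext adj [set: R] (F `|` old s) ((F `&` h (size s)) `|` nbr s) v.
  apply: hext.
    by rewrite finite_setU; split=> //; apply: finite_image; exact: finite_II.
  by move=> v [[Fv _]|[m [ms _] <-]]; [left | right; exists m].
have {step} [next nextP] := choice step.
pose build := fix build n := if n is k.+1 then rcons (build k) (next (build k)) else [::].
pose g n := next (build n).
have buildE n : build n = mkseq g n.
  by elim: n => //= n IH; rewrite /mkseq -addn1 iotaD map_cat cats1 -/(mkseq g n) -IH.
have sizeE n : size (build n) = n by rewrite buildE size_mkseq.
have nthE m n : (m < n)%N -> nth x0 (build n) m = g m.
  by move=> mn; rewrite buildE nth_mkseq.
have gP n : [/\ ~ (F `|` old (build n)) (g n),
    forall k, ((F `&` h n) `|` nbr (build n)) k -> adj (g n) k &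
    forall k, ((F `|` old (build n)) `\` ((F `&` h n) `|` nbr (build n))) k ->
      ~ adj (g n) k].
  by have [_ []] := nextP (build n); rewrite -/(g n) sizeE.
have gF n : ~ F (g n) by have [nF _ _] := gP n => Fg; apply: nF; left.
have oldg m n : (m < n)%N -> old (build n) (g m).
  by move=> mn; exists m => /=; rewrite ?sizeE ?nthE.
have g_lt m n : (m < n)%N -> g m <> g n.
  by move=> mn eq_g; have [nF _ _] := gP n; apply: nF; right; rewrite -eq_g; exact: oldg.
exists g => n; have [nF gK gN] := gP n; split=> // [a Fa|m mn].
  split=> [ga|ha]; last by apply: gK; left.
  apply: contrapT => nha; apply: gN ga; split; first by left.
  case=> [[] //|[m [/=]]]; rewrite sizeE => mn _.
  by rewrite nthE // => gma; apply: (gF m); rewrite gma.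
split=> [ga|emn]; last first.
  by apply: gK; right; exists m => /=; rewrite ?sizeE ?nthE.
apply: contrapT => nemn; apply: gN ga; split; first by right; exact: oldg.
(* A required neighbour [g k] could coincide with [g m] for another index; injectivity of [g] forces
   [k = m]. *)
case=> [[/gF] //|[k [/=]]]; rewrite sizeE => kn ekn; rewrite nthE // => gkm.
have [km|mk|eq_km] := ltngtP k m; first exact: g_lt km gkm.
  exact: g_lt mk (esym gkm).
by apply: nemn; rewrite -eq_km.
Qed.

(** Countability codes the pairs [(i, x)] injectively by naturals, so the clones form a subsequence
    of one recursive choice. Symmetry covers both orders of the codes, irreflexivity the equal
    ones. *)
Lemma rado_clones (I : finType) (F : set R) (h : I -> set R) :
  finite_set F ->
  exists c : I -> R -> R,
    [/\ forall i x, ~ F (c i x),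
        forall i x a, F a -> (adj (c i x) a <-> h i a) &
        forall i j x y, adj (c i x) (c j y) <-> adj x y].
Proof.
move=> Ffin; have [[irr sym] /countable_injP[p pinj] _] := hR.
pose code (i : I) x := choice.pickle (i, p x).
have codeI i j x y : code i x = code j y -> i = j /\ x = y.
  by move=> /(pcan_inj choice.pickleK)[-> /pinj->]; rewrite ?inE.
pose hn n := [set a | exists i x, code i x = n /\ h i a].
pose en m n := exists i x j y, [/\ code i x = m, code j y = n & adj x y].
have [g gP] := rado_embed_seq hn en Ffin.
exists (fun i x => g (code i x)); split=> [i x|i x a Fa|].
- by have [] := gP (code i x).
- have [_ + _] := gP (code i x) => -> //; split=> [[j [y [/codeI[-> _]]]]//|hia].
  by exists i, x.
have lt_adj i j x y : (code i x < code j y)%N ->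
    adj (g (code j y)) (g (code i x)) <-> adj x y.
  move=> lt; have [_ _ ->] := gP (code j y) => //; split=> [|xy]; last first.
    by exists i, x, j, y.
  by case=> [i' [x' [j' [y' [/codeI[_ ->] /codeI[_ ->]]]]]].
move=> i j x y; have [lt|lt|/codeI[-> ->]] := ltngtP (code i x) (code j y).
- by rewrite -(lt_adj _ _ _ _ lt); split; exact: sym.
- by rewrite (lt_adj _ _ _ _ lt); split; exact: sym.
- by split=> /irr.
Qed.

(** Otherwise [Z] could be added to [A], so lies in [A] by maximality, yet [Z] is compatible with
    itself. *)
Lemma maximal_antichain_compatible (A : set (set R)) Z :
  maximal_antichain adj A -> copies adj Z -> exists2 X, A X & compatible adj Z X.
Proof.
move=> [[Acop Aanti] Amax] Zcop; apply: contrapT => nX.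
have compC X Y : compatible adj X Y -> compatible adj Y X.
  by move=> [W Wcop WXY]; exists W => //; rewrite setIC.
have AZ : A Z.
  rewrite -(Amax (Z |` A)); [by left| |by move=> X AX; right].
  split=> [X [->|/Acop]//|X Y [->|AX] [->|AY] XY //].
  - by move=> ZY; apply: nX; exists Y.
  - by move=> /compC ZX; apply: nX; exists X.
  - exact: Aanti.
by apply: nX; exists Z => //; exists Z.
Qed.

Lemma maximal_antichain_refine (A : set (set R)) f : maximal_antichain adj A ->
  graph_embedding adj f ->
  exists u X, [/\ graph_embedding adj u, A X & forall x, X (f (u x))].
Proof.
move=> hA fE; have [X AX [Z [q [qZ _ _] qE] ZfX]] :=
  maximal_antichain_compatible hA (copies_range fE).
have {}qZ x : (range f `&` X) (q x) by apply/ZfX/qZ.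
(* The copy lies in [range f], so its embedding [q] factors as [f \o u]. *)
have pre x : exists y, f y = q x by have [[y _ <-] _] := qZ x; exists y.
have [u fu] := choice pre.
exists u, X; split=> // [x y|x]; last by rewrite fu; case: (qZ x).
by rewrite qE -!fu -fE.
Qed.

(** Each refinement composes [f] on the right, which only shrinks the ranges, so inclusions already
    obtained persist. *)
Lemma maximal_antichain_refine_all (A : set (set R)) (I : finType)
    (c : I -> R -> R) : maximal_antichain adj A ->
  (forall i, graph_embedding adj (c i)) ->
  exists2 f, graph_embedding adj f &
    forall i, exists2 X, A X & forall x, X (c i (f x)).
Proof.
move=> hA cE.
suff [f fE fA] : exists2 f, graph_embedding adj f &
    forall i, i \in enum I -> exists2 X, A X & forall x, X (c i (f x)).
  by exists f => // i; apply: fA; rewrite mem_enum.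
elim: (enum I) => [|i s [f fE fA]]; first by exists id.
have [u [X [uE AX uX]]] := maximal_antichain_refine hA (graph_embedding_comp (cE i) fE).
exists (f \o u); first exact: graph_embedding_comp.
move=> j; rewrite inE => /orP[/eqP->|/fA[Y AY fY]]; first by exists X.
by exists Y => // x; exact: fY.
Qed.

End RadoGraph.

Theorem theorem4p2 (R : Type) (adj : R -> R -> Prop) (hR : is_rado adj)
    (A : set (set R)) (hA : maximal_antichain adj A)
    (F0 : set R) (hF0 : finite_set F0) :
  exists S : set R,
    [/\ copies adj S, F0 `<=` S &
        forall H : set R, H `<=` F0 ->
          exists2 X : set R, A X & ext adj S F0 H `<=` X].
Proof.
have [[_ sym] _ _] := hR.
have [I [h [k hk]]] := finite_set_traces hF0.
have [c [cF ctrace cadj]] := rado_clones hR h hF0.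
have cE i : graph_embedding adj (c i) by move=> x y; rewrite cadj.
have [f fE fA] := maximal_antichain_refine_all hR hA cE.
pose tr x := k (F0 `&` adj x).
pose s x := if pselect (F0 x) is left _ then x else c (tr x) (f x).
have sF x : F0 x -> s x = x by rewrite /s; case: pselect.
have sN x : ~ F0 x -> s x = c (tr x) (f x) by rewrite /s; case: pselect.
have strace x a : F0 a -> adj (s x) a <-> adj x a.
  move=> Fa; have [Fx|nFx] := pselect (F0 x); first by rewrite sF.
  by rewrite sN // ctrace // hk; split=> [[_ []]|].
have sE : graph_embedding adj s.
  move=> x y; have [Fy|nFy] := pselect (F0 y).
    by rewrite (sF y) // strace.
  have [Fx|nFx] := pselect (F0 x).
    by rewrite (sF x) //; split=> /sym /(strace y x Fx) /sym.
  by rewrite !sN // cadj -fE.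
exists (range s); split; first exact: copies_range.
  by move=> a Fa; exists a => //; exact: sF.
move=> H HF; have [X AX fX] := fA (k H); exists X => //.
move=> _ [[x _ <-] [nFs sH sNH]].
have nFx : ~ F0 x by move=> Fx; apply: nFs; rewrite sF.
suff -> : s x = c (k H) (f x) by exact: fX.
(* As [s] preserves traces on [F0], the trace of [x] is exactly [H]. *)
rewrite sN // /tr; congr (c (k _) _); apply/seteqP; split=> a.
  move=> [Fa /(strace _ _ Fa) sa]; apply: contrapT => nHa.
  exact: sNH sa.
by move=> Ha; have Fa := HF a Ha; split=> //; apply/strace/sH.
Qed.
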